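(* Let $\mathcal{X}$ be an input set, $\mathcal{Y}$ an output set, and $\mathcal{F}$ a set of models $f:\mathcal{X}\to\mathcal{Y}$. Let $n,m\ge 1$. For $i=1,\dots,n$ let $t_i=(p_i,S_i,\ell_i)$ be a learning task, where $p_i$ is a probability distribution on $\mathcal{X}\times\mathcal{Y}$, $\ell_i:\mathcal{Y}\times\mathcal{Y}\to[0,1]$ is a loss function, and $S_i=\{(x_{i,1},y_{i,1}),\dots,(x_{i,m},y_{i,m})\}$ is a sample of size $m$ drawn i.i.d. from $p_i$, the samples $S_1,\dots,S_n$ being drawn independently of each other. Let $\mathcal{E}$ be a set (of ''global parameters'') and let $l:\mathcal{E}\to\mathbb{N}$ be the length function of a prefix-free encoding of $\mathcal{E}$ (the meta-encoder). For each $E\in\mathcal{E}$, let $l_E:\bigcup_{k=1}^\infty\mathcal{F}^k\to\mathbb{N}$ be the length function of a prefix-free encoding of $\bigcup_{k=1}^\infty\mathcal{F}^k$ (the multi-task encoder given $E$). Then for any $\delta>0$, with probability at least $1-\delta$ over the sampling of $S_1,\dots,S_n$, the following holds simultaneously for all $E\in\mathcal{E}$ and all $f_1,\dots,f_n\in\mathcal{F}$: $$\mathcal{R}(f_1,\dots,f_n)\le \widehat{\mathcal{R}}(f_1,\dots,f_n)+\sqrt{\frac{\big(l(E)+l_E(f_1,\dots,f_n)\big)\log 2+\log\frac{1}{\delta}}{2mn}}.$$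
   Context: A (prefix-free) encoding of a set $\mathcal{Z}$ is a map $C:\mathcal{Z}\to\{0,1\}^*$ such that for all $z\neq z'$ in $\mathcal{Z}$, $C(z)$ is not a prefix of $C(z')$; its length function is $z\mapsto$ length of the string $C(z)$. The multi-task risk is $\mathcal{R}(f_1,\dots,f_n)=\frac1n\sum_{i=1}^n \mathbb{E}_{(x,y)\sim p_i}\ell_i(y,f_i(x))$ and the multi-task empirical risk is $\widehat{\mathcal{R}}(f_1,\dots,f_n)=\frac{1}{mn}\sum_{i=1}^n\sum_{j=1}^m \ell_i(y_{i,j},f_i(x_{i,j}))$. *)

(* Defs.v *)
From HB Require Import structures.
From mathcomp Require Import all_boot all_order all_algebra.
From mathcomp Require Import all_classical all_reals all_analysis.
From Stdlib Require List.
Set Implicit Arguments. Unset Strict Implicit. Unset Printing Implicit Defensive.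
Import Order.TTheory GRing.Theory Num.Theory.
Local Open Scope classical_set_scope.
Local Open Scope ring_scope.

Definition prefix_free (T : Type) (D : set T) (C : T -> seq bool) : Prop :=
  forall z z', D z -> D z' -> z <> z' -> ~~ prefix (C z) (C z').

(* Domain of the multi-task encoder: \bigcup_{k>=1} F^k, as nonempty
   finite sequences of models of F. *)
Definition multi_models (X Y : Type) (F : set (X -> Y)) : set (seq (X -> Y)) :=
  [set s | (0 < size s)%N /\ forall f, List.In f s -> F f].

Definition mt_risk (R : realType) (dX dY : measure_display)
  (X : measurableType dX) (Y : measurableType dY) (n : nat)
  (p : 'I_n -> probability (X * Y)%type R) (loss : 'I_n -> Y -> Y -> R)
  (f : 'I_n -> X -> Y) : R :=
  n%:R^-1 * \sum_(i < n)
    fine (\int[p i]_z (loss i z.2 (f i z.1))%:E)%E.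

Definition mt_emp_risk (R : realType) (X Y : Type) (n m : nat)
  (S : 'I_n -> 'I_m -> (X * Y)%type) (loss : 'I_n -> Y -> Y -> R)
  (f : 'I_n -> X -> Y) : R :=
  (m * n)%:R^-1 * \sum_(i < n) \sum_(j < m) loss i (S i j).2 (f i (S i j).1).

(* The sample points Z i j (i < n, j < m) are mutually independent random
   variables on (Omega, P): product rule over every family of measurable sets
   (taking B = setT on some indices gives every subfamily). *)
Definition mutually_independent (R : realType) (dO dZ : measure_display)
  (Omega : measurableType dO) (Z : measurableType dZ) (P : probability Omega R)
  (n m : nat) (V : 'I_n -> 'I_m -> Omega -> Z) : Prop :=
  forall B : 'I_n -> 'I_m -> set Z, (forall i j, measurable (B i j)) ->
    P (\bigcap_(k in [set: 'I_n * 'I_m]) (V k.1 k.2 @^-1` B k.1 k.2)) =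
    (\prod_(k : 'I_n * 'I_m) P (V k.1 k.2 @^-1` B k.1 k.2))%E.

(* Main.v *)
(** Concatenating the meta-encoding of E with the encoding of (f_1, ..., f_n)
    given E yields a prefix-free code on pairs (E, f).  For a fixed pair,
    Hoeffding's inequality for the mn independent losses bounds the probability
    of violation by delta 2^-|c|, where c is the codeword of the pair.  The union
    bound over all pairs is taken down the binary tree of codewords, which
    incorporates Kraft's inequality. *)

Require Import Defs.
From HB Require Import structures.
From mathcomp Require Import all_boot all_order all_algebra.
From mathcomp Require Import all_classical all_reals all_analysis.
From mathcomp Require Import measurable_realfun ring lra.
Import Order.TTheory GRing.Theory Num.Theory.
Import numFieldNormedType.Exports.
Local Open Scope classical_set_scope.
Local Open Scope ring_scope.

(** * Calculus for the moment generating function of a Bernoulli variable *)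

Lemma is_derive_ge0_le (R : realType) (f f' : R -> R) (x : R) :
  (forall y, is_derive y (1 : R) f (f' y)) -> (forall y, 0 <= y -> 0 <= f' y) ->
  0 <= x -> f 0 <= f x.
Proof.
move=> df f'0 x0; apply: (@ger0_derive1_ndecry _ _ 0) => //.
- move=> y; rewrite in_itv/= andbT => y0.
  by rewrite derive1E (@derive_val _ _ _ _ _ _ _ (df y)) f'0// ltW.
- apply: continuous_subspaceT => y; apply/differentiable_continuous/derivable1_diffP.
  exact: (@ex_derive _ _ _ _ _ _ _ (df y)).
Qed.

(** The left side is the moment generating function of a Bernoulli variable of mean [p]. The second
    derivative of its logarithm is a Bernoulli variance, so at most 1/4; integrating twice from 0,
    where values and first derivatives agree, gives the bound. *)
Lemma hoeffding_scalar (R : realType) (p h : R) : 0 <= p <= 1 -> 0 <= h ->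
  1 - p + p * expR h <= expR (p * h + h ^+ 2 / 8).
Proof.
move=> /andP[p0 p1] h0.
pose D (x : R) := 1 - p + p * expR x.
have D0 x : 0 < D x.
  rewrite /D; have [->|pn1] := eqVneq p 1; first by rewrite subrr add0r mul1r expR_gt0.
  by rewrite ltr_wpDr ?mulr_ge0 ?expR_ge0// subr_gt0 lt_neqAle pn1.
have dD x : is_derive x (1 : R) D (p * expR x).
  by apply: is_derive_eq; rewrite /GRing.scale /=; ring.
(* g' is the derivative of the logarithm of the ratio of the two sides; its own
   derivative is the square ((1 - p - p e^x) / (2 D x))^2. *)
pose g' (x : R) := p + x / 4 - p * expR x / D x.
have dg' x : is_derive x (1 : R) g' (1 / 4 - (p * expR x * (1 - p)) / D x ^+ 2).
  have Dx0 := lt0r_neq0 (D0 x).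
  have dV := is_deriveV Dx0 (dD x).
  apply: is_derive_eq; rewrite /GRing.scale /=; move: Dx0; rewrite /D => Dx0.
  by field.
have dg x : is_derive x (1 : R) (fun x => p * x + x ^+ 2 / 8 - ln (D x)) (g' x).
  have dln := is_derive1_comp (is_derive1_ln (D0 x)) (dD x).
  rewrite [X in is_derive _ _ X](_ : _ =
    (fun x => p * x + x ^+ 2 / 8) - (@ln R \o D))//.
  apply: is_derive_eq; rewrite /g' /GRing.scale /=; move: (lt0r_neq0 (D0 x)) => Dx0.
  by field.
have g'0 x : 0 <= x -> 0 <= g' x.
  move=> x0; have -> : 0 = g' 0 by rewrite /g' /D expR0 mulr1 subrK divr1 mul0r addr0 subrr.
  apply: (@is_derive_ge0_le _ _ _ _ dg') x0 => y _.
  have Dy := D0 y.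
  rewrite -[X in 0 <= X](_ : ((1 - p - p * expR y) / (2 * D y)) ^+ 2 = _) ?sqr_ge0//.
  by move: Dy; rewrite /D => Dy; field; exact: lt0r_neq0.
rewrite -[leLHS]lnK; last exact: D0 h.
rewrite ler_expR -subr_ge0.
have := @is_derive_ge0_le _ _ _ _ dg g'0 h0.
by rewrite /D expR0 mulr1 subrK ln1 !mulr0 expr0n/= mul0r !addr0 subr0.
Qed.

(** * Union bound along the tree of codewords *)

(** The last hypothesis makes the strings with nonempty [Bad c] prefix-free. Instead of summing the
    weights, the proof carries the bound from children to parents in the tree cut [N] levels below a
    node, then lets [N] grow. *)
Lemma prefix_free_union_bound (d : measure_display) (T : measurableType d)
    (R : realType) (mu : {measure set T -> \bar R}) (delta : R)
    (Bad : seq bool -> set T) : 0 <= delta ->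
  (forall c, measurable (Bad c)) ->
  (forall c, (mu (Bad c) <= (delta / 2 ^+ size c)%:E)%E) ->
  (forall c d w, Bad c !=set0 -> Bad (c ++ d) w -> d = [::]) ->
  (mu (\bigcup_c Bad c) <= delta%:E)%E.
Proof.
move=> d0 mB B_le pf.
pose U N c := \bigcup_(e in [set e | (size e <= N)%N]) Bad (c ++ e).
have mU N c : measurable (U N c).
  by rewrite /U bigcup_mkcond; apply: countable_bigcupT_measurable => // e; case: ifP.
(* The events below the node c split between its two children, unless c is
   itself a codeword, in which case there are none strictly below it. *)
have U_le N : forall c, (mu (U N c) <= (delta / 2 ^+ size c)%:E)%E.
  elim: N => [|N IH] c; have [cB|/set0P/negP/negPn/eqP cB] := pselect (Bad c !=set0).
  - rewrite (_ : U _ _ = Bad c)//; apply/seteqP; split => [w [e _ Bw]|w Bw].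
      by move: (Bw); rewrite (pf _ _ _ cB Bw) cats0.
    by exists [::]; rewrite ?cats0.
  - rewrite (_ : U _ _ = set0) ?measure0 ?lee_fin ?divr_ge0 ?exprn_ge0//.
    by apply/seteqP; split => // w [[|//] _]; rewrite cats0 cB.
  - rewrite (_ : U _ _ = Bad c)//; apply/seteqP; split => [w [e _ Bw]|w Bw].
      by move: (Bw); rewrite (pf _ _ _ cB Bw) cats0.
    by exists [::]; rewrite ?cats0.
  - rewrite (_ : U _ _ = U N (rcons c true) `|` U N (rcons c false)).
      apply: le_trans (measureU2 _ _ _) _ => //.
      apply: le_trans (leeD (IH _) (IH _)) _.
      rewrite -EFinD lee_fin !size_rcons exprS.
      have e0 : 2 ^+ size c != 0 :> R by rewrite expf_neq0// pnatr_eq0.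
      by rewrite le_eqVlt; apply/orP; left; apply/eqP; field.
    apply/seteqP; split => [w [[_|[] e /= eN]]|w].
    + by rewrite cats0 cB.
    + by left; exists e => //; rewrite cat_rcons.
    + by right; exists e => //; rewrite cat_rcons.
    + by move=> [] [e /= eN]; rewrite cat_rcons => Bw;
        [exists (true :: e)|exists (false :: e)].
(* Each string lies at finite depth below the root, so the truncated unions at the root increase to
   the full union, and continuity from below applies. *)
have -> : \bigcup_c Bad c = \bigcup_N U N [::].
  apply/seteqP; split => [w [c _ Bw]|w [N _ [e _ Bw]]]; last by exists e.
  by exists (size c) => //; exists c => //=.
have ndU : nondecreasing_seq (fun N => U N [::]).
  move=> N M NM; apply/subsetPset => w [e /= eN Bw]; exists e => //=.
  exact: leq_trans NM.
have cU := nondecreasing_cvg_mu (mu := mu) (fun N => mU N [::])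
  (bigcup_measurable (fun N _ => mU N [::])) ndU.
rewrite -(cvg_lim _ cU)//; apply: lime_le; first by apply/cvg_ex; eexists; exact: cU.
by apply: nearW => N /=; have := U_le N [::]; rewrite /= expr0 divr1.
Qed.

(** * Expectations of products of independent variables *)

Import HBNNSimple.

(** Linearity extends the hypothesis from indicators to simple functions, and monotone convergence
    to [g]. Below, [H] is the product of the other factors and [c] the product of their
    expectations; finiteness of [c] lets it pass through the limit. *)
Lemma ge0_integral_indep (d d' : measure_display) (T : measurableType d)
    (Z : measurableType d') (R : realType) (mu : {measure set T -> \bar R})
    (V : T -> Z) (H : T -> R) (c : \bar R) (g : Z -> R) :
  measurable_fun [set: T] V -> measurable_fun [set: T] H -> (forall t, 0 <= H t) ->
  measurable_fun [set: Z] g -> (forall z, 0 <= g z) -> c \is a fin_num -> (0 <= c)%E ->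
  (forall B, measurable B ->
     \int[mu]_t (\1_B (V t) * H t)%:E = c * \int[mu]_t (\1_B (V t))%:E)%E ->
  (\int[mu]_t (g (V t) * H t)%:E = c * \int[mu]_t (g (V t))%:E)%E.
Proof.
move=> mV mH H0 mg g0 cfin c0 indep.
have mEg : measurable_fun [set: Z] (EFin \o g) by exact/measurable_EFinP.
pose a := nnsfun_approx measurableT mEg.
have ma n : measurable_fun [set: T] (a n \o V) by exact: measurableT_comp.
have a_cvg t : (a n (V t))%:E @[n --> \oo] --> (g (V t))%:E.
  by apply: (@cvg_nnsfun_approx _ _ _ _ measurableT _ mEg) => // z _; rewrite lee_fin.
have nda t : {homo (fun n => a n (V t)) : n k / (n <= k)%N >-> n <= k}.
  by move=> n k nk; exact/lefP/nd_nnsfun_approx.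
have simple n : (\int[mu]_t (a n (V t) * H t)%:E = c * \int[mu]_t (a n (V t))%:E)%E.
  have mI y : measurable_fun [set: T] (fun t => \1_(a n @^-1` [set y]) (V t) : R).
    by apply: measurableT_comp => //; exact: measurable_indic.
  have pos y z : 0 <= y * \1_(a n @^-1` [set y]) z.
    by have := nnfun_muleindic_ge0 (a n) y z; rewrite -EFinM lee_fin.
  under eq_integral => t _.
    rewrite fimfunE fsbig_finite//= mulr_suml -sumEFin. over.
  under [in RHS]eq_integral => t _.
    rewrite fimfunE fsbig_finite//= -sumEFin. over.
  have mL y : measurable_fun [set: T] (fun t => (y * \1_(a n @^-1` [set y]) (V t) * H t)%:E).
    by apply/measurable_EFinP; do 2 apply: measurable_funM => //.
  have mR y : measurable_fun [set: T] (fun t => (y * \1_(a n @^-1` [set y]) (V t))%:E).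
    by apply/measurable_EFinP; apply: measurable_funM.
  have posH y t : 0 <= y * \1_(a n @^-1` [set y]) (V t) * H t by rewrite mulr_ge0.
  rewrite !ge0_integral_sum//; do ?by move=> y t _; rewrite lee_fin.
  rewrite ge0_sume_distrr; last by move=> y _; apply: integral_ge0 => t _; rewrite lee_fin.
  (* Only attained values [y = a n z] are kept: they are nonnegative, as needed to pull them out of
     the integrals. *)
  rewrite !big_seq; apply: eq_bigr => y; rewrite in_fset_set// inE => -[z _ <-].
  have mB : measurable (a n @^-1` [set a n z]) by [].
  under eq_integral => t _ do rewrite -mulrA EFinM.
  under [in RHS]eq_integral => t _ do rewrite EFinM.
  rewrite !ge0_integralZl_EFin//; first last.
  - by apply/measurable_EFinP; apply: measurable_funM.
  - by move=> t _; rewrite lee_fin mulr_ge0.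
  - exact/measurable_EFinP.
  by rewrite indep// muleCA.
have cvgR : (\int[mu]_t (a n (V t))%:E)%E @[n --> \oo] --> (\int[mu]_t (g (V t))%:E)%E.
  under eq_integral => t _ do rewrite -(cvg_lim _ (a_cvg t))//.
  apply: cvg_monotone_convergence => //.
  - by move=> n; apply/measurable_EFinP; exact: ma.
  - by move=> n t _; rewrite lee_fin.
  - by move=> t _ n k nk; rewrite lee_fin; exact: nda.
have cvgL : (\int[mu]_t (a n (V t) * H t)%:E)%E @[n --> \oo] --> (\int[mu]_t (g (V t) * H t)%:E)%E.
  have aH_cvg t : (a n (V t) * H t)%:E @[n --> \oo] --> (g (V t) * H t)%:E.
    by under eq_fun do rewrite EFinM; rewrite EFinM; apply: cvgeZr.
  under eq_integral => t _ do rewrite -(cvg_lim _ (aH_cvg t))//.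
  apply: cvg_monotone_convergence => //.
  - by move=> n; apply/measurable_EFinP; apply: measurable_funM => //; exact: ma.
  - by move=> n t _; rewrite lee_fin mulr_ge0.
  - by move=> t _ n k nk; rewrite lee_fin ler_wpM2r//; exact: nda.
rewrite -(cvg_lim _ cvgL)//; apply: cvg_lim => //.
under eq_fun do rewrite simple.
exact: cvgeZl.
Qed.

Lemma probability_integral_itv (d : measure_display) (T : measurableType d)
    (R : realType) (P : probability T R) (f : T -> R) (M : R) :
  measurable_fun [set: T] f -> (forall t, 0 <= f t <= M) ->
  (0 <= \int[P]_t (f t)%:E <= M%:E)%E.
Proof.
move=> mf fM; have f0 t : 0 <= f t by have /andP[] := fM t.
have f_le t : f t <= M by have /andP[] := fM t.
rewrite integral_ge0/=; last by move=> t _; rewrite lee_fin.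
rewrite -[leRHS]mule1 -(probability_setT P) -integral_cst//.
apply: ge0_le_integral => //.
- by move=> t _; rewrite lee_fin.
- exact/measurable_EFinP.
- by move=> t _; rewrite lee_fin.
Qed.

Lemma ge0_integral_prod_indep (d d' : measure_display) (T : measurableType d)
    (Z : measurableType d') (R : realType) (P : probability T R) (K : finType)
    (V : K -> T -> Z) (G : K -> Z -> R) (M : R) :
  (forall k, measurable_fun [set: T] (V k)) ->
  (forall B : K -> set Z, (forall k, measurable (B k)) ->
    P (\bigcap_(k in [set: K]) (V k @^-1` B k)) = (\prod_k P (V k @^-1` B k))%E) ->
  (forall k, measurable_fun [set: Z] (G k)) -> (forall k z, 0 <= G k z <= M) ->
  (\int[P]_t (\prod_k G k (V k t))%:E = \prod_k \int[P]_t (G k (V k t))%:E)%E.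
Proof.
move=> mV indV mG.
(* Indicators are replaced by the G k one index at a time: s lists the indices
   where G k is not an indicator. *)
suff gen (s : seq K) : forall G : K -> Z -> R,
    (forall k, measurable_fun [set: Z] (G k)) -> (forall k z, 0 <= G k z <= Num.max M 1) ->
    (forall k, k \notin s -> exists2 B, measurable B & G k = \1_B) ->
    (\int[P]_t (\prod_k G k (V k t))%:E = \prod_k \int[P]_t (G k (V k t))%:E)%E.
  move=> GM; apply: (gen (enum K)) => // [k z|k]; last by rewrite mem_enum.
  by have /andP[-> /=] := GM k z; rewrite le_max => ->.
elim: s => [|k s IH] {}G {}mG GM GB.
  have /choice[B /all_and2[mB GE]] : forall k, exists B, measurable B /\ G k = \1_B.
    by move=> k; have [//|B mB GE] := GB k; exists B.
  (* When all factors are indicators, their product is the indicator of the intersection, and the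
     product rule for events applies. *)
  transitivity (\int[P]_t (\1_(\bigcap_(k in [set: K]) (V k @^-1` B k)) t)%:E)%E.
    apply: eq_integral => t _; congr EFin; under eq_bigr do rewrite GE indicE.
    rewrite indicE; case: (pselect (forall k, B k (V k t))) => [Bt|/existsNP[k nBk]].
      rewrite big1; first by rewrite mem_set// => k _; exact: Bt.
      by move=> k _; have /mem_set -> := Bt k.
    by rewrite (bigD1 k)//= memNset// mul0r memNset// => /(_ k) /(_ I).
  rewrite integral_indic//; last first.
    apply: fin_bigcap_measurable => // k _.
    by rewrite -[X in measurable X]setTI; exact: mV.
  rewrite setIT; etransitivity; first exact: indV.
  apply: eq_bigr => k _; rewrite GE.
  rewrite -[X in P X]setIT -integral_indic//; last first.
    rewrite -[X in measurable X]setTI; exact: mV.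
have [ks|ks] := boolP (k \in s).
  by apply: IH => // j js; apply: GB; rewrite inE negb_or js andbT; apply: contraNneq js => ->.
rewrite (bigD1 k)//= muleC; under eq_integral do rewrite (bigD1 k)//=.
have Gint j : (0 <= \int[P]_t (G j (V j t))%:E <= (Num.max M 1)%:E)%E.
  by apply: probability_integral_itv => //; exact: measurableT_comp.
apply: (@ge0_integral_indep _ _ _ _ _ _ (V k) (fun t => \prod_(i | i != k) G i (V i t))).
- exact: mV.
- under eq_fun do rewrite -big_filter; apply: measurable_prod => j _.
  exact: measurableT_comp.
- by move=> t; apply: prodr_ge0 => i _; have /andP[] := GM i (V i t).
- exact: mG.
- by move=> z; have /andP[] := GM k z.
- apply: prode_fin_num => j _; have /andP[I0 IM] := Gint j.
  by rewrite ge0_fin_numE// (le_lt_trans IM)// ltry.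
- by apply: prode_ge0 => j _; have /andP[] := Gint j.
(* With [\1_B] in place of [G k], the index [k] leaves the list and the induction hypothesis
   applies. *)
move=> B mB; pose G' i : Z -> R := if i == k then \1_B else G i.
have G'E i : i != k -> G' i = G i by rewrite /G' => /negPf ->.
have G'k : G' k = \1_B by rewrite /G' eqxx.
transitivity (\int[P]_t (\prod_i G' i (V i t))%:E)%E.
  apply: eq_integral => t _; rewrite [in RHS](bigD1 k)//= G'k; congr (_ * _)%:E.
  by apply: eq_bigr => i /G'E ->.
rewrite IH; first last.
- move=> j js; have [->|jk] := eqVneq j k; first by exists B.
  by rewrite G'E//; apply: GB; rewrite inE negb_or jk.
(* The 1 in [Num.max M 1] covers the indicator, which [M] may fail to bound. *)
- move=> j z; have [->|jk] := eqVneq j k; last by rewrite G'E.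
  by rewrite G'k indicE ler0n/= le_max lern1 leq_b1 orbT.
- move=> j; have [->|jk] := eqVneq j k; last by rewrite G'E.
  by rewrite G'k; exact: measurable_indic.
rewrite (bigD1 k)//= muleC G'k; congr (_ * _)%E.
by apply: eq_bigr => i /G'E ->.
Qed.

(** * Hoeffding's inequality for independent variables in [0, 1] *)

(** This is convexity of the exponential on [0, h], proved by monotonicity in [h]: the difference
    vanishes at 0, and its derivative is nonnegative because [x * w <= x]. *)
Lemma expR_le_chord (R : realType) (w h : R) : 0 <= w <= 1 -> 0 <= h ->
  expR (h * w) <= 1 - w + w * expR h.
Proof.
move=> /andP[w0 w1] h0; rewrite -subr_ge0.
have df x : is_derive x (1 : R) (fun y => 1 - w + w * expR y - expR (y * w))
    (w * (expR x - expR (x * w))).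
  have dxw : is_derive x (1 : R) (fun y => y * w) w.
    by apply: is_derive_eq; rewrite /GRing.scale /=; ring.
  have dexp := @is_derive1_comp _ _ (fun y => y * w) _ _ _ (is_derive_expR (x * w)) dxw.
  rewrite [X in is_derive _ _ X](_ : _ =
    (fun y => 1 - w + w * expR y) - (@expR R \o (fun y => y * w)))//.
  by apply: is_derive_eq; rewrite /GRing.scale /=; ring.
have := @is_derive_ge0_le _ _ _ _ df _ h0.
rewrite mul0r expR0 mulr1 subrK subrr; apply=> y y0.
by rewrite mulr_ge0// subr_ge0 ler_expR ler_piMr.
Qed.

(** The chord bound reduces the claim to a Bernoulli variable. As the deviation is mean minus value,
    the chord is taken in [1 - Y], and [hoeffding_scalar] is used at [1 - mu]. *)
Lemma hoeffding_mgf (d : measure_display) (T : measurableType d) (R : realType)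
    (P : probability T R) (Y : T -> R) (h : R) :
  measurable_fun [set: T] Y -> (forall t, 0 <= Y t <= 1) -> 0 <= h ->
  (\int[P]_t (expR (h * (fine (\int[P]_t (Y t)%:E) - Y t)))%:E
    <= (expR (h ^+ 2 / 8))%:E)%E.
Proof.
move=> mY Y01 h0.
have iY : P.-integrable [set: T] (EFin \o Y).
  apply: (@le_integrable _ _ _ _ _ measurableT _ (cst 1%:E)) => //.
  - exact/measurable_EFinP.
  - by move=> t _ /=; have /andP[Y0 Y1] := Y01 t; rewrite lee_fin !ger0_norm.
  - exact: finite_measure_integrable_cst.
have Yfin := integrable_fin_num measurableT iY.
set mu := fine _; have muE : (\int[P]_t (Y t)%:E)%E = mu%:E by rewrite fineK.
have mu01 : 0 <= mu <= 1.
  by have := @probability_integral_itv _ _ _ P _ _ mY Y01; rewrite muE !lee_fin.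
apply: (@le_trans _ _ (\int[P]_t (expR (h * (mu - 1)) * (Y t + (1 - Y t) * expR h))%:E)%E).
  apply: ge0_le_integral => //.
  - apply/measurable_EFinP; apply: measurableT_comp => //; apply: measurable_funM => //.
    exact: measurable_funB.
  - apply/measurable_EFinP; apply: measurable_funM => //; apply: measurable_funD => //.
    by apply: measurable_funM => //; exact: measurable_funB.
  - move=> t _; rewrite lee_fin.
    have -> : h * (mu - Y t) = h * (mu - 1) + h * (1 - Y t) by ring.
    rewrite expRD ler_wpM2l ?expR_ge0//.
    have w01 : 0 <= 1 - Y t <= 1 by have := Y01 t; lra.
    by have := @expR_le_chord _ _ _ w01 h0; rewrite subKr.
(* The chord bound is affine in [Y], so its integral depends only on [mu]. *)
under eq_integral => t _.
  rewrite (_ : _ * _ = (expR (h * (mu - 1)) * (1 - expR h)) * Y t + expR (h * (mu - 1)) * expR h); last by ring.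
  rewrite EFinD EFinM. over.
rewrite integralD//=; first last.
- exact: finite_measure_integrable_cst.
- exact: integrableZl.
rewrite integralZl// integral_cst//= (@probability_setT _ _ _ P) mule1 muE -EFinM -EFinD lee_fin.
have q01 : 0 <= 1 - mu <= 1 by lra.
have := @hoeffding_scalar _ _ _ q01 h0.
rewrite -(ler_pM2l (expR_gt0 (h * (mu - 1)))) -[X in _ <= X -> _]expRD.
rewrite (_ : h * (mu - 1) + ((1 - mu) * h + h ^+ 2 / 8) = h ^+ 2 / 8); last by ring.
apply: le_trans; rewrite le_eqVlt; apply/orP; left; apply/eqP; ring.
Qed.

(** Chernoff's method: the exponential of the sum of deviations is integrated, independence factors
    the integral, and [hoeffding_mgf] bounds each factor. *)
Lemma hoeffding_tail (d d' : measure_display) (T : measurableType d)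
    (Z : measurableType d') (R : realType) (P : probability T R) (K : finType)
    (V : K -> T -> Z) (psi : K -> Z -> R) (s : R) :
  (forall k, measurable_fun [set: T] (V k)) ->
  (forall B : K -> set Z, (forall k, measurable (B k)) ->
    P (\bigcap_(k in [set: K]) (V k @^-1` B k)) = (\prod_k P (V k @^-1` B k))%E) ->
  (forall k, measurable_fun [set: Z] (psi k)) -> (forall k z, 0 <= psi k z <= 1) ->
  (0 < #|K|)%N -> 0 <= s ->
  (P [set t | s <= (#|K|)%:R^-1 *
        \sum_k (fine (\int[P]_t (psi k (V k t))%:E) - psi k (V k t))]%R
    <= (expR (- (2 * #|K|%:R * s ^+ 2)))%:E)%E.
Proof.
move=> mV indV mpsi psi01 K0 s0.
set N := #|K|%:R; have N0 : 0 < N :> R by rewrite ltr0n.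
pose mu k := fine (\int[P]_t (psi k (V k t))%:E).
(* h = 4 s minimises the exponent N h^2 / 8 - N h s of the Chernoff bound. *)
pose h := 4 * s; have h0 : 0 <= h by rewrite mulr_ge0.
have mu01 k : 0 <= mu k <= 1.
  have : (0 <= \int[P]_t (psi k (V k t))%:E <= 1%:E)%E.
    by apply: probability_integral_itv => //; exact: measurableT_comp.
  move=> /andP[I0 I1]; rewrite -!lee_fin fineK ?I0 ?I1//.
  by rewrite ge0_fin_numE// (le_lt_trans I1)// ltry.
pose G k (z : Z) := expR (h * (mu k - psi k z)).
have mG k : measurable_fun [set: Z] (G k).
  apply: measurableT_comp => //; apply: measurable_funM => //.
  exact: measurable_funB.
have GM k z : 0 <= G k z <= expR h.
  rewrite expR_ge0 ler_expR ler_piMr//.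
  by have := mu01 k; have := psi01 k z; lra.
have mGV k : measurable_fun [set: T] (fun t => G k (V k t)) by exact: measurableT_comp.
have mprod : measurable_fun [set: T] (fun t => \prod_k G k (V k t)).
  by apply: measurable_prod.
have posP t : 0 <= \prod_k G k (V k t) by rewrite prodr_ge0// => k _; exact: expR_ge0.
set A := [set t | _].
have mA : measurable A.
  rewrite -[X in measurable X]setTI; apply: measurable_fun_le => //.
  apply: measurable_funM => //; apply: measurable_sum => k.
  by apply: measurable_funB => //; exact: measurableT_comp.
(* This is Markov's inequality pointwise: the indicator of [A] lies below the normalized
   exponential. *)
have AE t : A t -> 1 <= expR (- (N * h * s)) * \prod_k G k (V k t).
  rewrite /A /= -expR_sum -mulr_sumr -expRD -expR0 ler_expR -/N mulrC ler_pdivlMr// => st.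
  rewrite addrC subr_ge0 mulrAC mulrC ler_wpM2l// mulrC; exact: st.
rewrite -[A]setIT -integral_indic//.
apply: (@le_trans _ _ (\int[P]_t ((expR (- (N * h * s)))%:E * (\prod_k G k (V k t))%:E))%E).
  apply: ge0_le_integral => //.
  - exact/measurable_EFinP/measurable_indic.
  - by apply/measurable_EFinP; exact: measurable_funM.
  - move=> t _; rewrite -EFinM lee_fin indicE.
    have [|_] := boolP (t \in A); last by rewrite mulr_ge0 ?expR_ge0.
    by rewrite inE => /AE.
rewrite ge0_integralZl_EFin//; [|by move=> t _; rewrite lee_fin|exact/measurable_EFinP].
rewrite (@ge0_integral_prod_indep _ _ _ _ _ _ _ _ _ (expR h))//.
have /andP[_ prod_le] :
    (0 <= \prod_k \int[P]_t (G k (V k t))%:E <= (expR (h ^+ 2 / 8) ^+ #|K|)%:E)%E.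
  rewrite -prodr_const -prodEFin; elim/big_rec2: _ => [|k x y _ /andP[x0 xy]].
    by rewrite lexx lee_fin ler01.
  have I0 : (0 <= \int[P]_t (G k (V k t))%:E)%E.
    by apply: integral_ge0 => t _; rewrite lee_fin expR_ge0.
  rewrite mule_ge0//=; apply: lee_pmul => //.
  apply: (@hoeffding_mgf _ _ _ P (psi k \o V k)) => // [|t /=].
    exact: measurableT_comp.
  exact: psi01.
apply: le_trans (lee_wpmul2l _ prod_le) _; first by rewrite lee_fin expR_ge0.
rewrite -EFinM lee_fin -expRM_natl -expRD ler_expR.
rewrite -/N /h; lra.
Qed.

(** * Unique decoding, and the risk gap as a sample average *)

(** Of two initial segments of one string, the shorter is a prefix of the longer, which
    prefix-freeness forbids for distinct [z] and [z']. *)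
Lemma prefix_free_cat_inj (T : Type) (D : set T) (C : T -> seq bool) (z z' : T)
    (e e' : seq bool) :
  prefix_free D C -> D z -> D z' -> C z ++ e = C z' ++ e' -> z = z' /\ e = e'.
Proof.
move=> pf Dz Dz' eqC; have zz' : z = z'.
  have pfx (a b x y : seq bool) : (size a <= size b)%N -> a ++ x = b ++ y -> prefix a b.
    move=> ab /(congr1 (take (size a))).
    by rewrite take_size_cat// takel_cat// prefixE => <-.
  apply: contrapT => zz'; have [le|/ltnW le] := leqP (size (C z)) (size (C z')).
    by have /negP := pf _ _ Dz Dz' zz'; apply; exact: pfx eqC.
  by have /negP := pf _ _ Dz' Dz (nesym zz'); apply; exact: pfx (esym eqC).
by split => //; move: eqC; rewrite zz' => /eqP; rewrite eqseq_cat// eqxx => /eqP.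
Qed.

(** This brings the gap to the form bounded by [hoeffding_tail]. Expectations under [p i] move to
    [Omega] by pushforward along [S i j]; repeating each of them [m] times turns the factor 1/n into
    1/(mn). *)
Lemma mt_risk_gapE (R : realType) (dX dY dO : measure_display)
    (X : measurableType dX) (Y : measurableType dY) (n m : nat)
    (p : 'I_n -> probability (X * Y)%type R) (loss : 'I_n -> Y -> Y -> R)
    (Omega : measurableType dO) (P : probability Omega R)
    (S : 'I_n -> 'I_m -> Omega -> (X * Y)%type) (f : 'I_n -> X -> Y) (w : Omega) :
  (0 < n)%N -> (0 < m)%N -> (forall i a b, 0 <= loss i a b) ->
  (forall i, measurable_fun [set: (X * Y)%type] (fun z : X * Y => loss i z.2 (f i z.1))) ->
  (forall i j, measurable_fun [set: Omega] (S i j)) ->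
  (forall i j (B : set (X * Y)%type), measurable B -> P (S i j @^-1` B) = p i B) ->
  mt_risk p loss f - mt_emp_risk (fun i j => S i j w) loss f =
  #|{: 'I_n * 'I_m}|%:R^-1 * \sum_(k : 'I_n * 'I_m)
    (fine (\int[P]_t (loss k.1 (S k.1 k.2 t).2 (f k.1 (S k.1 k.2 t).1))%:E)
     - loss k.1 (S k.1 k.2 w).2 (f k.1 (S k.1 k.2 w).1)).
Proof.
move=> n0 m0 loss0 mf mS dS.
have intE i j : (\int[P]_t (loss i (S i j t).2 (f i (S i j t).1))%:E =
    \int[p i]_z (loss i z.2 (f i z.1))%:E)%E.
  transitivity (\int[pushforward P (S i j)]_z (loss i z.2 (f i z.1))%:E)%E; last first.
    by apply: eq_measure_integral => B mB _; exact: dS.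
  rewrite ge0_integral_pushforward//; first exact/measurable_EFinP.
  by move=> z _; rewrite lee_fin.
under eq_bigr do rewrite intE.
rewrite big_split/= sumrN mulrBr -(pair_bigA _ (fun i j => loss i (S i j w).2 (f i (S i j w).1)))/=.
rewrite -(pair_bigA _ (fun i _ => fine (\int[p i]_z (loss i z.2 (f i z.1))%:E)))/=.
rewrite card_prod !card_ord /mt_emp_risk [(m * n)%N]mulnC; congr (_ - _).
rewrite /mt_risk; under [in RHS]eq_bigr do rewrite sumr_const card_ord -mulr_natr.
rewrite -mulr_suml natrM; field.
by rewrite !pnatr_eq0 -!lt0n n0 m0.
Qed.

(** * The bound holding uniformly over global parameters and models *)

Theorem theorem2 (R : realType) (dX dY dO : measure_display)
  (X : measurableType dX) (Y : measurableType dY)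
  (F : set (X -> Y)) (n m : nat) (hn : (0 < n)%N) (hm : (0 < m)%N)
  (p : 'I_n -> probability (X * Y)%type R)
  (loss : 'I_n -> Y -> Y -> R)
  (hloss : forall i a b, 0 <= loss i a b <= 1)
  (hmeas : forall i f, F f ->
     measurable_fun [set: (X * Y)%type] (fun z : X * Y => loss i z.2 (f z.1)))
  (Omega : measurableType dO) (P : probability Omega R)
  (S : 'I_n -> 'I_m -> Omega -> (X * Y)%type)
  (hSmeas : forall i j, measurable_fun [set: Omega] (S i j))
  (hSdist : forall i j (B : set (X * Y)%type), measurable B ->
     P (S i j @^-1` B) = p i B)
  (hSind : mutually_independent P S)
  (Eset : Type) (meta : Eset -> seq bool)
  (hmeta : prefix_free [set: Eset] meta)
  (enc : Eset -> seq (X -> Y) -> seq bool)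
  (henc : forall E, prefix_free (multi_models F) (enc E))
  (delta : R) (hdelta : 0 < delta) :
  exists A : set Omega, measurable A /\ ((1 - delta)%:E <= P A)%E /\
    forall w, A w -> forall (E : Eset) (f : 'I_n -> X -> Y),
      (forall i, F (f i)) ->
      mt_risk p loss f <=
        mt_emp_risk (fun i j => S i j w) loss f +
        Num.sqrt ((((size (meta E) + size (enc E [seq f i | i <- enum 'I_n]))%:R
                     * ln 2 + ln delta^-1)) / (2 * m * n)%:R).
Proof.
(* For delta > 1 the logarithm of 1 / delta is negative and Num.sqrt may
   return its junk value 0, but then P set0 = 0 is already enough. *)
have [d1|d1] := ltP 1 delta.
  exists set0; split; first exact: measurable0.
  by split; [rewrite measure0 lee_fin subr_le0 ltW|move=> w []].
have ld0 : 0 <= ln delta^-1 by rewrite ln_ge0// invf_ge1.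
pose K := ('I_n * 'I_m)%type; pose N : R := #|{: K}|%:R.
have NE : N = (n * m)%:R by rewrite /N card_prod !card_ord.
have N0 : 0 < N by rewrite NE ltr0n muln_gt0 hn.
pose code (E : Eset) (f : 'I_n -> X -> Y) := meta E ++ enc E [seq f i | i <- enum 'I_n].
(* The radius solves [expR (- (2 * N * r ^+ 2)) = delta / 2 ^+ size c] for [r]. *)
pose radius (c : seq bool) := Num.sqrt (((size c)%:R * ln 2 + ln delta^-1) / (2 * N)).
pose gap (f : 'I_n -> X -> Y) (w : Omega) :=
  mt_risk p loss f - mt_emp_risk (fun i j => S i j w) loss f.
pose viol E f := [set w | radius (code E f) <= gap f w].
pose psi (f : 'I_n -> X -> Y) (k : K) (z : X * Y) := loss k.1 z.2 (f k.1 z.1).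
have mpsi f : (forall i, F (f i)) -> forall k, measurable_fun [set: (X * Y)%type] (psi f k).
  by move=> Ff k; exact: hmeas.
have gapE f : (forall i, F (f i)) -> gap f = fun w => N^-1 * \sum_(k : K)
    (fine (\int[P]_t (psi f k (S k.1 k.2 t))%:E) - psi f k (S k.1 k.2 w)).
  move=> Ff; apply/funext => w.
  rewrite /gap (@mt_risk_gapE _ _ _ _ _ _ _ _ _ _ _ P)//.
  - by move=> i a b; have /andP[] := hloss i a b.
  - by move=> i; exact: hmeas.
have mviol E f : (forall i, F (f i)) -> measurable (viol E f).
  move=> Ff; rewrite -[X in measurable X]setTI; apply: measurable_fun_le => //.
  rewrite gapE//; apply: measurable_funM => //; apply: measurable_sum => k.
  by apply: measurable_funB => //; apply: measurableT_comp => //; exact: mpsi.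
have Pviol E f : (forall i, F (f i)) ->
    (P (viol E f) <= (delta / 2 ^+ size (code E f))%:E)%E.
  move=> Ff; rewrite /viol gapE//.
  have indK (B : K -> set (X * Y)%type) : (forall k, measurable (B k)) ->
      P (\bigcap_(k in [set: K]) (S k.1 k.2 @^-1` B k)) =
      (\prod_(k : K) P (S k.1 k.2 @^-1` B k))%E.
    move=> mB; have eB (k : K) : B (k.1, k.2) = B k by case: k.
    have := hSind (fun i j => B (i, j)) (fun i j => mB (i, j)).
    by under eq_bigcapr do rewrite eB; under [in RHS]eq_bigr do rewrite eB.
  apply: le_trans (@hoeffding_tail _ _ _ _ _ _ _ (fun k : K => S k.1 k.2) (psi f)
    (radius (code E f)) _ indK (mpsi f Ff) _ _ _) _ => //.
  - by move=> k z; exact: hloss.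
  - by rewrite card_prod !card_ord muln_gt0 hn.
  - exact: sqrtr_ge0.
  have ln2_ge0 : 0 <= ln 2 :> R by rewrite ln_ge0// ler1n.
  (* Squaring undoes [Num.sqrt] because the radicand is nonnegative, which uses [delta <= 1]. *)
  rewrite -/N lee_fin sqr_sqrtr; last first.
    by rewrite divr_ge0 ?addr_ge0 ?mulr_ge0.
  rewrite [2 * N * _]mulrC divfK; last by rewrite lt0r_neq0// mulr_gt0.
  by rewrite lnV ?posrE// opprB expRB lnK ?posrE// expRM_natl lnK ?posrE.
(* Decoding happens in two stages: the meta-code yields [E = E'], after which the same encoder
   [enc E] reads both remainders and leaves [d] empty. Since [0 < n], the lists of models are
   nonempty and lie in its domain. *)
have codeP E f E' f' d : (forall i, F (f i)) -> (forall i, F (f' i)) ->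
    code E f ++ d = code E' f' -> [/\ E = E', f = f' & d = [::]].
  move=> Ff Ff'; rewrite /code -!catA => eqc.
  have mmF g : (forall i, F (g i)) -> multi_models F [seq g i | i <- enum 'I_n].
    move=> Fg; split; first by rewrite size_map size_enum_ord.
    by move=> h; elim: (enum 'I_n) => //= i s IH [<-//|/IH].
  have [EE eqe] := @prefix_free_cat_inj _ _ _ E E' _ _ hmeta I I eqc.
  rewrite -{}EE in eqe *; rewrite -[enc E [seq f' i | i <- _]]cats0 in eqe.
  have [ff ->] := @prefix_free_cat_inj _ _ _ _ _ _ _ (henc E) (mmF _ Ff) (mmF _ Ff') eqe.
  split => //; apply/funext => i.
  by have /eq_in_map := ff; apply; rewrite mem_enum.
(* Indexing by bit strings makes the union countable; by unique decoding each [Bad c] is empty or a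
   single [viol E f]. *)
pose Bad c := \bigcup_(Ef in [set Ef : Eset * ('I_n -> X -> Y) |
  (forall i, F (Ef.2 i)) /\ code Ef.1 Ef.2 = c]) viol Ef.1 Ef.2.
have BadE E f : (forall i, F (f i)) -> Bad (code E f) = viol E f.
  move=> Ff; apply/seteqP; split => [w [[E' f'] /= [Ff' cc']]|w vw].
    by have [|-> -> _] := codeP E' f' E f [::] Ff' Ff; first by rewrite cats0.
  by exists (E, f).
have Bad0 c : Bad c !=set0 -> exists E f, (forall i, F (f i)) /\ c = code E f.
  by move=> [w [[E f] [/= Ff <-] _]]; exists E, f.
have [mB PB] : (forall c, measurable (Bad c)) /\
    forall c, (P (Bad c) <= (delta / 2 ^+ size c)%:E)%E.
  apply/all_and2 => c; have [/Bad0[E [f [Ff ->]]]|/set0P/negP/negPn/eqP ->] :=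
    pselect (Bad c !=set0).
    by rewrite BadE//; split; [exact: mviol|exact: Pviol].
  by rewrite measure0 lee_fin divr_ge0 ?exprn_ge0// ltW.
have mU : measurable (\bigcup_c Bad c) by exact: countable_bigcupT_measurable.
exists (~` \bigcup_c Bad c); split; first exact: measurableC.
split.
  rewrite probability_setC// EFinB leeB//.
  apply: prefix_free_union_bound => //; first exact: ltW.
  move=> c d w /Bad0[E [f [Ff ->]]] /(ex_intro _ w) /Bad0[E' [f' [Ff' cc']]].
  by have [] := codeP _ _ _ _ _ Ff Ff' cc'.
move=> w nBw E f Ff; rewrite -lerBlDl; apply: ltW.
have : ~ viol E f w by move=> vw; apply: nBw; exists (code E f); rewrite ?BadE.
rewrite /viol /= => /negP; rewrite -ltNge /gap /radius /code size_cat.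
by rewrite NE -natrM [(n * m)%N]mulnC mulnA.
Qed.
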